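(* The calculus RK is cut-free complete for the modal logic K: for every hypersequent $H$, if $H$ is valid in the class of all frames (i.e., there is no counter-example to $H$), then $H$ has a derivation in RK that does not use the Cut rule.
   Context: **Language.** Modal formulas are built from propositional variables by $\lnot,\land,\Box$. A frame is $\langle W,R\rangle$ with $W\neq\emptyset$, $R\subseteq W\times W$; a model $\mathfrak M=\langle W,R,V\rangle$ adds a valuation, and truth $\mathfrak M,w\models\varphi$ is the usual Kripke truth definition ($\Box\varphi$ is true at $w$ iff $\varphi$ is true at every $v$ with $wRv$). **Hypersequents.** A sequent is an expression $\Gamma\Rightarrow\Delta$ with $\Gamma,\Delta$ finite sets of formulas (written as comma-separated lists; $\varphi,\Gamma$ means $\{\varphi\}\cup\Gamma$, and $\varphi\in\Gamma$ is allowed). A hypersequent is a finite nonempty sequence of sequents $S_1\;/\!/\;\dots\;/\!/\; S_n$ (order and multiplicity matter). **Semantics.** $\mathfrak M$ is a countermodel to $\Gamma\Rightarrow\Delta$ at $w$ iff $\mathfrak M,w\models\varphi$ for all $\varphi\in\Gamma$ and $\mathfrak M,w\not\models\psi$ for all $\psi\in\Delta$. $\mathfrak M$ is a counter-example to $\Gamma_1\Rightarrow\Delta_1\;/\!/\;\dots\;/\!/\;\Gamma_n\Rightarrow\Delta_n$ iff there are worlds $w_1,\dots,w_n$ with $w_iRw_{i+1}$ for $1\le i<n$ such that $\mathfrak M$ is a countermodel to $\Gamma_i\Rightarrow\Delta_i$ at $w_i$ for every $i$. A hypersequent is valid in a class of frames iff no model based on a frame in the class is a counter-example to it. **The calculus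 RK.** Derivations are finite trees of hypersequents whose leaves are axioms $\varphi\Rightarrow\varphi$ (one-component hypersequents) and which are built by the following rules. Here $G,H$ are possibly empty sequences of sequents unless otherwise said; ''premise(s) / conclusion''. - WL: $G\;/\!/\;\Gamma\Rightarrow\Delta\;/\!/\; H$ / $G\;/\!/\;\varphi,\Gamma\Rightarrow\Delta\;/\!/\; H$. - WR: $G\;/\!/\;\Gamma\Rightarrow\Delta\;/\!/\; H$ / $G\;/\!/\;\Gamma\Rightarrow\Delta,\varphi\;/\!/\; H$. - Cut: $G\;/\!/\;\Gamma\Rightarrow\Delta,\varphi\;/\!/\; H$ and $G\;/\!/\;\varphi,\Lambda\Rightarrow\Theta\;/\!/\; H$ / $G\;/\!/\;\Gamma,\Lambda\Rightarrow\Delta,\Theta\;/\!/\; H$. - EWR: $G$ / $G\;/\!/\;\ \Rightarrow\ $ ($G$ a hypersequent; an empty sequent is appended on the right). - EWL: $G$ / $\ \Rightarrow\ \;/\!/\; G$ ($G$ a hypersequent; an empty sequent is prepended on the left). - $\lnot$L: $G\;/\!/\;\Gamma\Rightarrow\Delta,\varphi\;/\!/\; H$ / $G\;/\!/\;\lnot\varphi,\Gamma\Rightarrow\Delta\;/\!/\; H$. - $\lnot$R: $G\;/\!/\;\varphi,\Gamma\Rightarrow\Delta\;/\!/\; H$ / $G\;/\!/\;\Gamma\Rightarrow\Delta,\lnot\varphi\;/\!/\; H$. - $\land$L$_1$: $G\;/\!/\;\varphi,\Gamma\Rightarrow\Delta\;/\!/\; H$ / $G\;/\!/\;\varphi\land\psi,\Gamma\Rightarrow\Delta\;/\!/\;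 H$. - $\land$L$_2$: $G\;/\!/\;\psi,\Gamma\Rightarrow\Delta\;/\!/\; H$ / $G\;/\!/\;\varphi\land\psi,\Gamma\Rightarrow\Delta\;/\!/\; H$. - $\land$R: $G\;/\!/\;\Gamma\Rightarrow\Delta,\varphi\;/\!/\; H$ and $G\;/\!/\;\Gamma\Rightarrow\Delta,\psi\;/\!/\; H$ / $G\;/\!/\;\Gamma\Rightarrow\Delta,\varphi\land\psi\;/\!/\; H$. - $\Box$L: $G\;/\!/\;\Gamma\Rightarrow\Delta\;/\!/\;\varphi,\Lambda\Rightarrow\Theta\;/\!/\; H$ / $G\;/\!/\;\Box\varphi,\Gamma\Rightarrow\Delta\;/\!/\;\Lambda\Rightarrow\Theta\;/\!/\; H$. - $\Box$R: $H\;/\!/\;\Gamma\Rightarrow\Delta\;/\!/\;\ \Rightarrow\varphi$ / $H\;/\!/\;\Gamma\Rightarrow\Delta,\Box\varphi$ (the active components are rightmost). *)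

(* Defs.v *)
From HB Require Import structures.
From mathcomp Require Import all_boot.
From mathcomp Require Import finmap.

Set Implicit Arguments.
Unset Strict Implicit.
Unset Printing Implicit Defensive.

Local Open Scope fset_scope.

Inductive form : Type :=
| Var of nat
| Neg of form
| And of form & form
| Box of form.

(* Countable structure on formulas, so that finite sets of formulas can be
   represented by {fset form}. *)
Fixpoint tree_of_form (f : form) : GenTree.tree nat :=
  match f with
  | Var n => GenTree.Leaf n
  | Neg f => GenTree.Node 0 [:: tree_of_form f]
  | And f g => GenTree.Node 1 [:: tree_of_form f; tree_of_form g]
  | Box f => GenTree.Node 2 [:: tree_of_form f]
  end.

Fixpoint form_of_tree (t : GenTree.tree nat) : option form :=
  match t with
  | GenTree.Leaf n => Some (Var n)
  | GenTree.Node 0 [:: t] => omap Neg (form_of_tree t)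
  | GenTree.Node 1 [:: t; u] =>
      obind (fun f => omap (And f) (form_of_tree u)) (form_of_tree t)
  | GenTree.Node 2 [:: t] => omap Box (form_of_tree t)
  | _ => None
  end.

Lemma tree_of_formK : pcancel tree_of_form form_of_tree.
Proof. by elim=> [n|f IHf|f IHf g IHg|f IHf] //=; rewrite ?IHf ?IHg. Qed.

HB.instance Definition _ := Countable.copy form (pcan_type tree_of_formK).

Record frame : Type := Frame {
  world : Type;
  rel : world -> world -> Prop;
  world_nonempty : inhabited world
}.

Record model : Type := Model {
  model_frame : frame;
  valuation : nat -> world model_frame -> Prop
}.

Fixpoint truth (M : model) (w : world (model_frame M)) (f : form) : Prop :=
  match f with
  | Var n => valuation n w
  | Neg g => ~ truth w g
  | And g h => truth w g /\ truth w h
  | Box g => forall v, rel w v -> truth v g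
  end.

Record sequent : Type := Sequent {
  antecedent : {fset form};
  succedent : {fset form}
}.

Notation "Gamma ⇒ Delta" := (Sequent Gamma Delta)
  (at level 60, no associativity).

(* A hypersequent is a nonempty element of this type.  Nonemptiness is stated
   explicitly wherever the shape of the list does not already imply it. *)
Definition hypersequent : Type := seq sequent.

Definition countermodel (M : model) (w : world (model_frame M)) (S : sequent) :
    Prop :=
  (forall f, f \in antecedent S -> truth w f) /\
  (forall f, f \in succedent S -> ~ truth w f).

Definition counterexample (M : model) (H : hypersequent) : Prop :=
  exists w : 'I_(size H) -> world (model_frame M),
    (forall i j : 'I_(size H), val j = (val i).+1 -> rel (w i) (w j)) /\
    (forall i : 'I_(size H), countermodel (w i) (tnth (in_tuple H) i)).

Definition valid_in (C : frame -> Prop) (H : hypersequent) : Prop :=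
  forall M : model, C (model_frame M) -> ~ counterexample M H.

Definition all_frames : frame -> Prop := fun _ => True.

(* Derivation trees, indexed by their conclusion.  As sides of sequents are
   sets, both "f, Gamma" and "Gamma, f" are f |` Gamma. *)
Inductive RK : hypersequent -> Type :=
| Ax f :
    RK [:: [fset f] ⇒ [fset f]]
| WL G H f Gamma Delta :
    RK (G ++ (Gamma ⇒ Delta) :: H) ->
    RK (G ++ (f |` Gamma ⇒ Delta) :: H)
| WR G H f Gamma Delta :
    RK (G ++ (Gamma ⇒ Delta) :: H) ->
    RK (G ++ (Gamma ⇒ f |` Delta) :: H)
| Cut G H f Gamma Delta Lambda Theta :
    RK (G ++ (Gamma ⇒ f |` Delta) :: H) ->
    RK (G ++ (f |` Lambda ⇒ Theta) :: H) ->
    RK (G ++ (Gamma `|` Lambda ⇒ Delta `|` Theta) :: H)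
| EWR G :
    G <> [::] ->
    RK G ->
    RK (G ++ [:: fset0 ⇒ fset0])
| EWL G :
    G <> [::] ->
    RK G ->
    RK ((fset0 ⇒ fset0) :: G)
| NegL G H f Gamma Delta :
    RK (G ++ (Gamma ⇒ f |` Delta) :: H) ->
    RK (G ++ (Neg f |` Gamma ⇒ Delta) :: H)
| NegR G H f Gamma Delta :
    RK (G ++ (f |` Gamma ⇒ Delta) :: H) ->
    RK (G ++ (Gamma ⇒ Neg f |` Delta) :: H)
| AndL1 G H f g Gamma Delta :
    RK (G ++ (f |` Gamma ⇒ Delta) :: H) ->
    RK (G ++ (And f g |` Gamma ⇒ Delta) :: H)
| AndL2 G H f g Gamma Delta :
    RK (G ++ (g |` Gamma ⇒ Delta) :: H) ->
    RK (G ++ (And f g |` Gamma ⇒ Delta) :: H)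
| AndR G H f g Gamma Delta :
    RK (G ++ (Gamma ⇒ f |` Delta) :: H) ->
    RK (G ++ (Gamma ⇒ g |` Delta) :: H) ->
    RK (G ++ (Gamma ⇒ And f g |` Delta) :: H)
| BoxL G H f Gamma Delta Lambda Theta :
    RK (G ++ [:: Gamma ⇒ Delta, f |` Lambda ⇒ Theta & H]) ->
    RK (G ++ [:: Box f |` Gamma ⇒ Delta, Lambda ⇒ Theta & H])
| BoxR H f Gamma Delta :
    RK (H ++ [:: Gamma ⇒ Delta; fset0 ⇒ [fset f]]) ->
    RK (H ++ [:: Gamma ⇒ Box f |` Delta]).

Fixpoint cut_free (H : hypersequent) (d : RK H) : bool :=
  match d with
  | Ax _ => true
  | Cut _ _ _ _ _ _ _ _ _ => false
  | WL _ _ _ _ _ d | WR _ _ _ _ _ d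
  | EWR _ _ d | EWL _ _ d
  | NegL _ _ _ _ _ d | NegR _ _ _ _ _ d
  | AndL1 _ _ _ _ _ _ d | AndL2 _ _ _ _ _ _ d
  | BoxL _ _ _ _ _ _ _ d | BoxR _ _ _ _ d => cut_free d
  | AndR _ _ _ _ _ _ d1 d2 => cut_free d1 && cut_free d2
  end.

(* Main.v *)
(** If [H] has no cut-free derivation, saturate its components from left to
    right, keeping the hypersequent underivable.  The worlds of the countermodel
    are underivable hypersequents [G // S] whose last component [S] is
    saturated, and [G // S] sees exactly the worlds [G // S // S'].  A false
    [Box f] in [S] is witnessed by saturating the last component of
    [G // S // => f], which is underivable by BoxR.  BoxR acts only on the
    rightmost component, but this is harmless: every prefix of an underivable
    hypersequent is underivable (EWR and weakening), and is itself a world. *)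

Require Import Defs.
From mathcomp Require Import all_boot finmap.
From Stdlib Require Import Classical.

Set Implicit Arguments.
Unset Strict Implicit.
Unset Printing Implicit Defensive.

Local Open Scope fset_scope.

(** * Cut-free derivability and weakening *)

Definition cf_derivable (H : hypersequent) : Prop := exists d : RK H, cut_free d.

Definition subsequent (S T : sequent) : bool :=
  (antecedent S `<=` antecedent T) && (succedent S `<=` succedent T).

Lemma subsequent_refl S : subsequent S S.
Proof. by rewrite /subsequent !fsubset_refl. Qed.

Lemma subsequent_trans T S U :
  subsequent S T -> subsequent T U -> subsequent S U.
Proof.
move=> /andP[a b] /andP[c d]; apply/andP.
by split; [exact: fsubset_trans c | exact: fsubset_trans d].
Qed.

Lemma fset1U_id (f : form) (A : {fset form}) : f \in A -> f |` A = A.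
Proof. by move=> fA; apply/fsetUidPr; rewrite fsub1set. Qed.

Lemma fset_extend (P : {fset form} -> Prop) (A B : {fset form}) :
  (forall f C, P C -> P (f |` C)) -> A `<=` B -> P A -> P B.
Proof.
move=> stepP sAB PA.
(* The induction runs on a list [s] enumerating what is added to [A]; [C] is fixed only up to
   membership, so repetitions in [s] or overlaps with [A] do no harm. *)
suff Ps (s : seq form) C : (forall x, (x \in C) = (x \in s) || (x \in A)) -> P C.
  apply: (Ps (enum_fset B)) => x.
  by apply/idP/orP => [->|[//|/(fsubsetP sAB)]]; [left|].
elim: s C => [|f s IHs] C eC.
  by suff -> : C = A by []; apply/fsetP.
suff -> : C = f |` ([fset x in s] `|` A).
  by apply: stepP; apply: IHs => x; rewrite !inE.
by apply/fsetP => x; rewrite eC !inE orbA.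
Qed.

Lemma cf_weakening G H S T :
  subsequent S T -> cf_derivable (G ++ S :: H) -> cf_derivable (G ++ T :: H).
Proof.
case: S T => [A B] [A' B'] /andP[/= sA sB] dS.
have dl : cf_derivable (G ++ (A' ⇒ B) :: H).
  apply: (fset_extend (P := fun C => cf_derivable (G ++ (C ⇒ B) :: H))) sA dS.
  by move=> f C [d cd]; exists (WL f d).
apply: (fset_extend (P := fun C => cf_derivable (G ++ (A' ⇒ C) :: H))) sB dl.
by move=> f C [d cd]; exists (WR f d).
Qed.

Lemma empty_subsequent S : subsequent (fset0 ⇒ fset0) S.
Proof. by rewrite /subsequent !fsub0set. Qed.

(** EWR appends only the empty sequent, which internal weakening then fills; the components of [H]
    are appended one at a time. *)
Lemma cf_external_weakening_right G H :
  G <> [::] -> cf_derivable G -> cf_derivable (G ++ H).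
Proof.
elim: H G => [|S H IHH] G G0 dG; first by rewrite cats0.
rewrite -cat_rcons; apply: IHH; first by case: (G).
rewrite -cats1; apply: cf_weakening (empty_subsequent S) _.
by case: dG => d cd; exists (EWR G0 d).
Qed.

Lemma cf_external_weakening_left G H :
  H <> [::] -> cf_derivable H -> cf_derivable (G ++ H).
Proof.
move=> H0 dH; elim: G => [//|S G [d cd]] /=.
apply: (cf_weakening (G := [::])) (empty_subsequent S) _ => /=.
have GH0 : G ++ H <> [::] by case: (G).
by exists (EWL GH0 d).
Qed.

Lemma cf_init G H S f :
  f \in antecedent S -> f \in succedent S -> cf_derivable (G ++ S :: H).
Proof.
move=> fA fB; apply: cf_external_weakening_left => //.
apply: (cf_external_weakening_right (G := [:: S])) => //.
apply: (cf_weakening (G := [::]) (S := [fset f] ⇒ [fset f])).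
  by rewrite /subsequent /= !fsub1set fA.
by exists (Ax f).
Qed.

(** * Logical rules that keep their principal formula *)

Definition addL f (S : sequent) := f |` antecedent S ⇒ succedent S.
Definition addR f (S : sequent) := antecedent S ⇒ f |` succedent S.

Lemma subsequent_addL f S : subsequent S (addL f S).
Proof. by rewrite /subsequent /= fsubsetU1 fsubset_refl. Qed.

Lemma subsequent_addR f S : subsequent S (addR f S).
Proof. by rewrite /subsequent /= fsubsetU1 fsubset_refl. Qed.

(** Sides are sets, so the context of the rule may already contain the principal formula:
    contraction is built in. Read contrapositively, this and the next lemmas say what may be added
    to an underivable hypersequent. *)
Lemma cf_negL G H S f : Neg f \in antecedent S ->
  cf_derivable (G ++ addR f S :: H) -> cf_derivable (G ++ S :: H).
Proof.
by case: S => A B /= fA [d cd]; rewrite -(fset1U_id fA); exists (NegL d).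
Qed.

Lemma cf_negR G H S f : Neg f \in succedent S ->
  cf_derivable (G ++ addL f S :: H) -> cf_derivable (G ++ S :: H).
Proof.
by case: S => A B /= fB [d cd]; rewrite -(fset1U_id fB); exists (NegR d).
Qed.

Lemma cf_andL1 G H S f g : And f g \in antecedent S ->
  cf_derivable (G ++ addL f S :: H) -> cf_derivable (G ++ S :: H).
Proof.
by case: S => A B /= fA [d cd]; rewrite -(fset1U_id fA); exists (AndL1 g d).
Qed.

Lemma cf_andL2 G H S f g : And f g \in antecedent S ->
  cf_derivable (G ++ addL g S :: H) -> cf_derivable (G ++ S :: H).
Proof.
by case: S => A B /= fA [d cd]; rewrite -(fset1U_id fA); exists (AndL2 f d).
Qed.

Lemma cf_andR G H S f g : And f g \in succedent S ->
  cf_derivable (G ++ addR f S :: H) -> cf_derivable (G ++ addR g S :: H) ->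
  cf_derivable (G ++ S :: H).
Proof.
case: S => A B /= fB [d cd] [d' cd']; rewrite -(fset1U_id fB).
by exists (AndR d d'); rewrite /= cd.
Qed.

Lemma cf_boxL G H S T f : Box f \in antecedent S ->
  cf_derivable (G ++ [:: S, addL f T & H]) -> cf_derivable (G ++ [:: S, T & H]).
Proof.
case: S T => A B [A' B'] /= fA [d cd].
by rewrite -(fset1U_id fA); exists (BoxL d).
Qed.

Lemma cf_boxR G S f : Box f \in succedent S ->
  cf_derivable (G ++ [:: S; fset0 ⇒ [fset f]]) -> cf_derivable (G ++ [:: S]).
Proof.
by case: S => A B /= fB [d cd]; rewrite -(fset1U_id fB); exists (BoxR d).
Qed.

(** * Finite subformula-closed sets *)

Definition subformulas_in (F : {fset form}) (f : form) : Prop :=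
  match f with
  | Var _ => True
  | Neg g | Box g => g \in F
  | And g h => g \in F /\ h \in F
  end.

Definition subformula_closed (F : {fset form}) : Prop :=
  forall f, f \in F -> subformulas_in F f.

Lemma subformulas_in_mono E F f :
  E `<=` F -> subformulas_in E f -> subformulas_in F f.
Proof.
by move/fsubsetP => sEF; case: f => [n|g|g h|g] /= => [|/sEF|[/sEF ? /sEF]|/sEF].
Qed.

Lemma subformula_closedU E F :
  subformula_closed E -> subformula_closed F -> subformula_closed (E `|` F).
Proof.
move=> cE cF f; rewrite inE => /orP[/cE|/cF]; apply: subformulas_in_mono.
  exact: fsubsetUl.
exact: fsubsetUr.
Qed.

Lemma subformula_closedU1 f F :
  subformula_closed F -> subformulas_in F f -> subformula_closed (f |` F).
Proof.
move=> cF fF g; rewrite in_fset1U => gF.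
apply: (subformulas_in_mono (fsubsetU1 f F)).
by case/orP: gF => [/eqP->|/cF].
Qed.

Lemma subformula_closure1 f : exists2 F, subformula_closed F & f \in F.
Proof.
suff [F cF fF] : exists2 F, subformula_closed F & subformulas_in F f.
  exists (f |` F); last exact: fset1U1.
  exact: subformula_closedU1.
elim: f => [n|f [F cF fF]|f [F cF fF] g [E cE gE]|f [F cF fF]].
- by exists fset0.
- exists (f |` F); last by rewrite /= fset1U1.
  exact: subformula_closedU1.
- exists ((f |` F) `|` (g |` E)); last by rewrite /= !inE !eqxx !orbT.
  by apply: subformula_closedU; apply: subformula_closedU1.
- exists (f |` F); last by rewrite /= fset1U1.
  exact: subformula_closedU1.
Qed.

Lemma subformula_closure (A : {fset form}) :
  exists2 F, subformula_closed F & A `<=` F.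
Proof.
apply: (fset_extend (P := fun C => exists2 F, subformula_closed F & C `<=` F))
  (fsub0set A) _.
  move=> f C [F cF sCF]; have [E cE fE] := subformula_closure1 f.
  exists (E `|` F); first exact: subformula_closedU.
  by apply: fsetUSS => //; rewrite fsub1set.
by exists fset0.
Qed.

(** * Saturation of one component *)

Lemma addL_mono f S T : subsequent S T -> subsequent (addL f S) (addL f T).
Proof. by case/andP => a b; rewrite /subsequent /= fsetUS. Qed.

Lemma addR_mono f S T : subsequent S T -> subsequent (addR f S) (addR f T).
Proof. by case/andP => a b; rewrite /subsequent /= fsetUS ?andbT. Qed.

Lemma subsequentP S T :
  subsequent S T ->
  {subset antecedent S <= antecedent T} /\ {subset succedent S <= succedent T}.
Proof. by case/andP => /fsubsetP a /fsubsetP b. Qed.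

Definition underivable G S H : Prop := ~ cf_derivable (G ++ S :: H).

Lemma underivable_mono G H S T :
  subsequent S T -> underivable G T H -> underivable G S H.
Proof. by move=> sST uT /(cf_weakening sST). Qed.

(** A finite Lindenbaum construction. One pass over [F] suffices: subsequents of underivable
    components are underivable, so a formula that can be added to the final [T] could already be
    added when its turn came. *)
Lemma maximal_extension G H (F : {fset form}) S :
  subsequent S (F ⇒ F) -> underivable G S H ->
  exists T, [/\ subsequent S T, subsequent T (F ⇒ F), underivable G T H,
    (forall f, f \in F -> underivable G (addL f T) H -> f \in antecedent T) &
    (forall f, f \in F -> underivable G (addR f T) H -> f \in succedent T)].
Proof.
move=> sSF uS.
suff [T [sST sTF uT mT]] : exists T, [/\ subsequent S T, subsequent T (F ⇒ F),
    underivable G T H &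
    forall f, f \in enum_fset F ->
      (underivable G (addL f T) H -> f \in antecedent T) /\
      (underivable G (addR f T) H -> f \in succedent T)].
  by exists T; split => // f /mT[].
have : {subset enum_fset F <= F} by [].
elim: (enum_fset F) S sSF uS => [|f s IHs] S sSF uS sF.
  by exists S; rewrite subsequent_refl.
have fF : f \in F by apply: sF; rewrite inE eqxx.
have /andP[/= aF bF] := sSF.
(* Try [f] on the left first, then on the right of the result. *)
have [S1 [sS1 sF1 u1 m1]] : exists S1, [/\ subsequent S S1,
    subsequent S1 (F ⇒ F), underivable G S1 H &
    underivable G (addL f S) H -> f \in antecedent S1].
  have [u|nu] := classic (underivable G (addL f S) H); last first.
    by exists S; rewrite subsequent_refl.
  exists (addL f S); split => //; first exact: subsequent_addL.
    by rewrite /subsequent /= fsubUset fsub1set fF aF bF.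
  by rewrite in_fset1U eqxx.
have /andP[/= aF1 bF1] := sF1.
have [S2 [sS2 sF2 u2 m2]] : exists S2, [/\ subsequent S1 S2,
    subsequent S2 (F ⇒ F), underivable G S2 H &
    underivable G (addR f S1) H -> f \in succedent S2].
  have [u|nu] := classic (underivable G (addR f S1) H); last first.
    by exists S1; rewrite subsequent_refl.
  exists (addR f S1); split => //; first exact: subsequent_addR.
    by rewrite /subsequent /= fsubUset fsub1set fF aF1 bF1.
  by rewrite in_fset1U eqxx.
have [|T [sT TF uT mT]] := IHs S2 sF2 u2.
  by move=> g gs; apply: sF; rewrite inE gs orbT.
have s1T := subsequent_trans sS2 sT.
exists T; split => //; first exact: subsequent_trans s1T.
move=> g; rewrite inE => /orP[/eqP->{g}|/mT//]; split=> u.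
  apply: (proj1 (subsequentP s1T)); apply: m1.
  exact: underivable_mono (addL_mono _ (subsequent_trans sS1 s1T)) u.
apply: (proj2 (subsequentP sT)); apply: m2.
exact: underivable_mono (addR_mono _ s1T) u.
Qed.

(** The clause for a true box looks back to the last component of the prefix. A box in the succedent
    has no clause, since its witness lies in a further component. *)
Record saturated (G : hypersequent) (S : sequent) : Prop := Saturated {
  sat_disjoint f : f \in antecedent S -> f \in succedent S -> False;
  sat_negL f : Neg f \in antecedent S -> f \in succedent S;
  sat_negR f : Neg f \in succedent S -> f \in antecedent S;
  sat_andL f g :
    And f g \in antecedent S -> f \in antecedent S /\ g \in antecedent S;
  sat_andR f g :
    And f g \in succedent S -> f \in succedent S \/ g \in succedent S;
  sat_boxL G' T f :
    G = rcons G' T -> Box f \in antecedent T -> f \in antecedent S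
}.

(** A formula demanded by a clause is in [T] by maximality: otherwise adding it gives a derivable
    hypersequent, and the matching rule derives the one with [T]. *)
Lemma saturation G H S : underivable G S H ->
  exists T, [/\ subsequent S T, saturated G T & underivable G T H].
Proof.
move=> uS.
(* The preceding component is included because its boxes put formulas into [T]; for empty [G] the
   default [S] adds nothing new. *)
have [F cF] := subformula_closure
  (antecedent S `|` succedent S `|` antecedent (last S G)).
rewrite !fsubUset -andbA => /and3P[sA sB /fsubsetP sL].
have [|T [sST sTF uT mL mR]] := @maximal_extension G H F S _ uS.
  by rewrite /subsequent /= sA.
have [aF bF] := subsequentP sTF.
exists T; split => //; split.
- by move=> f fA fB; apply: uT; apply: cf_init fA fB.
- move=> f fA; apply: mR; first exact: cF (aF _ fA).
  by move/(cf_negL fA)/uT.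
- move=> f fB; apply: mL; first exact: cF (bF _ fB).
  by move/(cf_negR fB)/uT.
- move=> f g fA; have [fF gF] := cF _ (aF _ fA).
  by split; apply: mL => //; [move/(cf_andL1 fA)/uT | move/(cf_andL2 fA)/uT].
- move=> f g fB; have [fF gF] := cF _ (bF _ fB).
  (* If neither conjunct were present, both premises of the conjunction rule would be derivable. *)
  apply: NNPP => /not_or_and[nf ng]; apply: nf; apply: (mR) => // df.
  by apply: ng; apply: mR => // /(cf_andR fB df)/uT.
- move=> G' U f eG fU; apply: mL.
    by apply: (cF (Box f)); apply: sL; rewrite eG last_rcons.
  by move: uT; rewrite /underivable eG !cat_rcons => uT /(cf_boxL fU)/uT.
Qed.

(** * The canonical model *)

(* The pair [(G, S)] stands for the hypersequent [G // S]. *)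
Definition canonical_world : Type :=
  {p : hypersequent * sequent | saturated p.1 p.2 /\ underivable p.1 p.2 [::]}.

Definition world_prefix (w : canonical_world) : hypersequent := (sval w).1.
Definition world_sequent (w : canonical_world) : sequent := (sval w).2.

Definition canonical_rel (w v : canonical_world) : Prop :=
  world_prefix v = rcons (world_prefix w) (world_sequent w).

Definition canonical_model (i : inhabited canonical_world) : model :=
  @Model (@Frame canonical_world canonical_rel i)
    (fun n w => Var n \in antecedent (world_sequent w)).

Lemma underivable_world G S H : underivable G S H ->
  exists w, [/\ world_prefix w = G, subsequent S (world_sequent w) &
    underivable G (world_sequent w) H].
Proof.
move=> /saturation[T [sST satT uT]].
(* A world must be underivable without the components [H] to its right. *)
have u0 : underivable G T [::].
  move=> dT; apply: uT; rewrite -cat_rcons -cats1.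
  by apply: cf_external_weakening_right dT; case: (G).
by exists (exist _ (G, T) (conj satT u0)).
Qed.

(** Both sides are proved together because negation swaps them. Only implications hold in general: a
    world need not decide every formula. *)
Lemma canonical_truth i f (w : world (model_frame (canonical_model i))) :
  (f \in antecedent (world_sequent w) -> truth w f) /\
  (f \in succedent (world_sequent w) -> ~ truth w f).
Proof.
elim: f w => [n|f IHf|f IHf g IHg|f IHf] w; have [satw uw] := svalP w.
- by split => //= fB fA; exact: (sat_disjoint satw fA fB).
- split=> /= [/(sat_negL satw)|/(sat_negR satw)]; first by case: (IHf w).
  by case: (IHf w) => + _ fA => /(_ fA) tf; apply.
- split=> /= [/(sat_andL satw)[fA gA]|/(sat_andR satw)[fB|gB] []].
  + by split; [apply: (proj1 (IHf w)) | apply: (proj1 (IHg w))].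
  + by move=> tf _; case: (IHf w) => _ /(_ fB).
  + by move=> _ tg; case: (IHg w) => _ /(_ gB).
- split=> /= [bA v wv|bB tb].
    (* By [wv] the sequent of [w] is the last component of the prefix of [v]. *)
    by apply: (proj1 (IHf v)); exact: (sat_boxL (svalP v).1 wv bA).
  have uf : underivable (rcons (world_prefix w) (world_sequent w))
      (fset0 ⇒ [fset f]) [::].
    by rewrite /underivable cat_rcons => /(cf_boxR bB)/uw.
  have [v [ev sv _]] := underivable_world uf.
  case: (IHf v) => _; apply; last exact: tb.
  by apply: (proj2 (subsequentP sv)); rewrite inE.
Qed.

(** Each saturated component joins the prefix before the next is saturated, so consecutive worlds
    are related by construction. *)
Lemma canonical_chain G S H : underivable G S H ->
  exists w : nat -> canonical_world,
    [/\ world_prefix (w 0) = G,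
      forall j, j < size H -> canonical_rel (w j) (w j.+1) &
      forall j, j <= size H -> subsequent (nth S (S :: H) j) (world_sequent (w j))].
Proof.
elim: H G S => [|T H IHH] G S /underivable_world[v [ev sv uv]].
  (* Values of the chain beyond [size H] are arbitrary. *)
  by exists (fun=> v); split => // -[].
rewrite /underivable -cat_rcons in uv.
have [w [w0 wR wS]] := IHH _ _ uv.
exists (fun j => if j is k.+1 then w k else v); split => //.
  by case=> [_|j]; [rewrite /canonical_rel w0 ev | exact: wR].
by case=> [//|j] jH /=; rewrite (set_nth_default T) //; exact: wS.
Qed.

Theorem corollary25 (H : hypersequent) (H_nonempty : H <> [::])
  (H_valid : valid_in all_frames H) :
  exists d : RK H, cut_free d.
Proof.
apply: NNPP => uH; case: H H_nonempty H_valid uH => // S H _ validH uH.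
have [w [_ wR wS]] := @canonical_chain [::] S H uH.
(* The first world of the chain shows that the frame is nonempty. *)
apply: (validH (canonical_model (inhabits (w 0))) I).
exists (fun i : 'I_(size (S :: H)) => w i); split=> [i j ij|i].
  have jH := ltn_ord j; rewrite /= in ij jH *.
  by rewrite ij in jH *; exact: wR.
have [sA sB] := subsequentP (wS i (ltn_ord i)).
by rewrite (tnth_nth S) /=; split=> f fS;
  case: (@canonical_truth (inhabits (w 0)) f (w i)) => tA tB;
  [apply: tA; apply: sA | apply: tB; apply: sB].
Qed.
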